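(* Let $0<\alpha\le 2$, $N\in\mathbb N$, $u_0\in L^2_{\mathrm{per}}(\Omega)$ real-valued, and let $u_N$ be the semi-discrete Fourier spectral Galerkin approximation, i.e. the continuously differentiable function of time with values in $\mathbb X_N$ satisfying $$(\partial_t u_N, v) + ((-\Delta)^{\alpha/2} u_N, \partial_{x_1} v) - \tfrac12 (u_N^2, \partial_{x_1} v) = 0 \quad \forall v\in\mathbb X_N,\qquad (u_N(0),v)=(u_0,v)\quad\forall v\in\mathbb X_N .$$ Then the scheme conserves mass, momentum and Hamiltonian energy: at every time $t$ in the interval of existence of $u_N$, $$\frac{d}{dt}\mathcal I(u_N)=0,\qquad \frac{d}{dt}\mathcal M(u_N)=0,\qquad \frac{d}{dt}\mathcal H(u_N)=0 .$$
   Context: $\Omega=[-\pi,\pi]^2$ with periodic boundary conditions (the two-dimensional torus), $\mathbf x=(x_1,x_2)$. All functions are real-valued. $L^2_{\mathrm{per}}(\Omega)$ has inner product $(u,v)=\int_\Omega u\overline v\,d\mathbf x$ and norm $\|u\|=(u,u)^{1/2}$. Fourier coefficients: $\hat f(\mathbf k)=(2\pi)^{-2}\int_\Omega f(\mathbf x)e^{-i\mathbf k\cdot\mathbf x}\,d\mathbf x$, $\mathbf k\in\mathbb Z^2$. For $\beta\ge0$, $(-\Delta)^{\beta/2}f(\mathbf x)=\sum_{\mathbf k\in\mathbb Z^2}|\mathbf k|^{\beta}\hat f(\mathbf k)e^{i\mathbf k\cdot\mathbf x}$, where $|\mathbf k|^2=k_1^2+k_2^2$. $\mathbb X_N$ is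 the space of (real-valued) trigonometric polynomials in $\mathrm{span}\{e^{i\mathbf k\cdot\mathbf x}:|\mathbf k|_\infty=\max\{|k_1|,|k_2|\}\le N\}$. The functionals are $$\mathcal I(u)=\int_\Omega u\,d\mathbf x,\qquad \mathcal M(u)=\int_\Omega u^2\,d\mathbf x,\qquad \mathcal H(u)=\frac12\int_\Omega\left|(-\Delta)^{\alpha/4}u\right|^2d\mathbf x-\frac16\int_\Omega u^3\,d\mathbf x .$$ The scheme approximates the fractional Zakharov--Kuznetsov equation $\partial_t u-\partial_{x_1}(-\Delta)^{\alpha/2}u+u\,\partial_{x_1}u=0$ with $u(\cdot,0)=u_0$. *)

(* Defs.v *)
From HB Require Import structures.
From mathcomp Require Import all_boot all_order all_algebra complex.
From mathcomp Require Import all_classical all_reals all_analysis.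
From mathcomp Require Import zify ring lra.

Set Implicit Arguments.
Unset Strict Implicit.
Unset Printing Implicit Defensive.

Import Order.TTheory GRing.Theory Num.Theory numFieldNormedType.Exports.

Local Open Scope classical_set_scope.
Local Open Scope ring_scope.
Local Open Scope complex_scope.

(* The wave numbers k in Z^2 with |k|_oo <= N, see [mem_freqs]. *)
Definition freqs (N : nat) : seq (int * int) :=
  [seq (i%:Z - N%:Z, j%:Z - N%:Z) | i <- iota 0 N.*2.+1, j <- iota 0 N.*2.+1].

Lemma mem_freqs (N : nat) (k : int * int) :
  (k \in freqs N) = (maxn `|k.1|%N `|k.2|%N <= N)%N.
Proof.
have D (i : nat) : (i < 0 + N.*2.+1)%N -> (absz (i%:Z - N%:Z)%R <= N)%N by lia.
have E (a : int) : (absz a <= N)%N ->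
    (absz (a + N%:Z)%R < 0 + N.*2.+1)%N /\ a = (absz (a + N%:Z)%R)%:Z - N%:Z.
  by lia.
case: k => a b; rewrite geq_max.
apply/allpairsP/andP => [[[i j]] []|[/E[a1 a2] /E[b1 b2]]].
  by rewrite !mem_iota => /D hi /D hj [-> ->].
exists (absz (a + N%:Z), absz (b + N%:Z)); rewrite !mem_iota; split => //.
by congr pair.
Qed.

Lemma freqs_uniq (N : nat) : uniq (freqs N).
Proof.
apply: allpairs_uniq; rewrite ?iota_uniq//.
by move=> [i j] [i' j'] _ _ [] /= e1 e2; congr pair; lia.
Qed.

Section torus.
Context {R : realType}.
Implicit Types (f u v : R * R -> R) (k : int * int) (x : R * R).

Definition Omega : set (R * R) := `[- pi, pi]%classic `*` `[- pi, pi]%classic.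

Definition leb2 : {measure set (measurableTypeR R * measurableTypeR R) -> \bar R} :=
  (@lebesgue_measure R \x @lebesgue_measure R)%E.

Definition intOmega f : R := \int[leb2]_(x in Omega) f x.

Definition cintOmega (g : R * R -> R[i]) : R[i] :=
  intOmega (fun x => complex.Re (g x)) +i* intOmega (fun x => complex.Im (g x)).

(* All functions are real-valued, so no conjugation is needed. *)
Definition inner u v : R := intOmega (fun x => u x * v x).

Definition L2norm u : R := Num.sqrt (inner u u).

Definition periodic2 u : Prop :=
  forall x1 x2 : R, u (x1 + pi *+ 2, x2) = u (x1, x2) /\
                    u (x1, x2 + pi *+ 2) = u (x1, x2).

Definition L2per u : Prop :=
  [/\ periodic2 u,
      measurable_fun (Omega : set (measurableTypeR R * measurableTypeR R)) u &
      (\int[leb2]_(x in Omega) ((u x) ^+ 2)%:E < +oo)%E].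

Definition expi (t : R) : R[i] := cos t +i* sin t.

Definition dotk k x : R := k.1%:~R * x.1 + k.2%:~R * x.2.

Definition normk k : R := Num.sqrt (k.1%:~R ^+ 2 + k.2%:~R ^+ 2).

Definition fourier f k : R[i] :=
  (((pi *+ 2) ^- 2)%:C) * cintOmega (fun x => (f x)%:C * expi (- dotk k x)).

Definition fracLap_psum (beta : R) f (K : nat) x : R[i] :=
  \sum_(k <- freqs K) (normk k `^ beta)%:C * fourier f k * expi (dotk k x).

Let oppk k : int * int := (- k.1, - k.2).

Let oppkK : involutive oppk.
Proof. by case=> a b; rewrite /oppk /= !opprK. Qed.

Let dotk_opp k x : dotk (oppk k) x = - dotk k x.
Proof. by rewrite /dotk /= !mulrNz !mulNr opprD. Qed.

Let intOmegaN f : intOmega (fun x => - f x) = - intOmega f.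
Proof.
rewrite /intOmega /Rintegral integralE [in RHS]integralE.
have -> : (fun x => (- f x)%:E) = (\- (EFin \o f))%E by [].
rewrite funeposN funenegN.
set a := integral _ _ (_^\+)%E; set b := integral _ _ (_^\-)%E.
case: a => [a| |]; case: b => [b| |] //=; rewrite ?oppr0//.
by rewrite opprB.
Qed.

Let fourier_opp f k : fourier f (oppk k) = (fourier f k)^*.
Proof.
rewrite /fourier /cintOmega /expi.
have -> : intOmega (fun x => complex.Im ((f x)%:C *
    (cos (- dotk (oppk k) x) +i* sin (- dotk (oppk k) x)))) =
  - intOmega (fun x => complex.Im ((f x)%:C *
    (cos (- dotk k x) +i* sin (- dotk k x)))).
  rewrite -intOmegaN; congr intOmega; apply/funext => x /=.
  by rewrite dotk_opp !opprK !sinN; ring.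
have -> : intOmega (fun x => complex.Re ((f x)%:C *
    (cos (- dotk (oppk k) x) +i* sin (- dotk (oppk k) x)))) =
  intOmega (fun x => complex.Re ((f x)%:C *
    (cos (- dotk k x) +i* sin (- dotk k x)))).
  congr intOmega; apply/funext => x /=.
  by rewrite dotk_opp !opprK !cosN !mul0r !subr0.
by simpc; congr (_ +i* _); ring.
Qed.

Lemma fracLap_psum_real (beta : R) f (K : nat) x :
  complex.Im (fracLap_psum beta f K x) = 0.
Proof.
pose F k := complex.Im ((normk k `^ beta)%:C * fourier f k * expi (dotk k x)).
have -> : complex.Im (fracLap_psum beta f K x) = \sum_(k <- freqs K) F k.
  rewrite /fracLap_psum (big_morph (@complex.Im R) (id1 := 0) (op1 := +%R))//.
  by move=> [a b] [c d].
have FN k : F (oppk k) = - F k.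
  rewrite /F fourier_opp dotk_opp /expi cosN sinN.
  have -> : normk (oppk k) = normk k by rewrite /normk /= !mulrNz !sqrrN.
  by case: (fourier f k) => a b /=; ring.
have pK : perm_eq (freqs K) (map oppk (freqs K)).
  apply: uniq_perm; first exact: freqs_uniq.
    by rewrite map_inj_uniq ?freqs_uniq//; exact: inv_inj.
  move=> k; rewrite -[k in RHS]oppkK mem_map; last exact: inv_inj.
  by rewrite !mem_freqs /=; case: k => a b /=; rewrite !abszN.
have : \sum_(k <- freqs K) F k = - \sum_(k <- freqs K) F k.
  rewrite [LHS](perm_big _ pK) big_map -sumrN.
  by apply: eq_bigr => k _.
lra.
Qed.

(* The series over Z^2 is the limit of the square partial sums, which are real
   by [fracLap_psum_real]; for a trigonometric polynomial they are eventually
   constant.  Note that 0 `^ 0 = 1, so that beta = 0 gives the identity. *)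
Definition fracLap (beta : R) f x : R :=
  limn (fun K => complex.Re (fracLap_psum beta f K x)).

Definition XN (N : nat) v : Prop :=
  exists c : int * int -> R[i],
    forall x, (v x)%:C = \sum_(k <- freqs N) c k * expi (dotk k x).

Definition pd1 v x : R := 'D_(1, 0) v x.

Definition mass u : R := intOmega u.

Definition momentum u : R := intOmega (fun x => u x ^+ 2).

Definition energy (alpha : R) u : R :=
  2^-1 * intOmega (fun x => `|fracLap (alpha / 2) u x| ^+ 2)
  - 6^-1 * intOmega (fun x => u x ^+ 3).

(* Derivatives in time are taken within the interval J, hence they are
   one-sided at an endpoint belonging to J. *)
Definition deriv_within (J : set R) (F : R -> R) (t l : R) : Prop :=
  (fun s => (F s - F t) / (s - t)) @ within J t^' --> l.

(* du is the time derivative of the curve u in XN N, and it is continuous,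
   XN N being normed as a subspace of L^2_per. *)
Definition C1_curve (N : nat) (J : set R) (u du : R -> R * R -> R) : Prop :=
  forall t, J t ->
    [/\ XN N (u t), XN N (du t),
        (fun s => L2norm ((s - t)^-1 *: (u s - u t) - du t))
          @ within J t^' --> (0 : R) &
        (fun s => L2norm (du s - du t)) @ within J (nbhs t) --> (0 : R)].

Definition galerkin_solution (alpha : R) (N : nat) u0 (J : set R)
    (u : R -> R * R -> R) : Prop :=
  exists du : R -> R * R -> R,
    [/\ C1_curve N J u du,
        forall t, J t -> forall v, XN N v ->
          inner (du t) v + inner (fracLap alpha (u t)) (pd1 v)
          - 2^-1 * inner (fun x => u t x ^+ 2) (pd1 v) = 0 &
        forall v, XN N v -> inner (u 0) v = inner u0 v].

End torus.

(* Main.v *)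
Require Import Defs.
From mathcomp Require Import all_boot all_order all_algebra complex.
From mathcomp Require Import all_classical all_reals all_analysis measurable_realfun.
From mathcomp Require Import zify ring lra.

(** Throughout, a function v of X_N is identified with its finite family of Fourier
    coefficients, [expands c N v].  Orthogonality of the exponentials over Omega
    ([cintOmega_expi]) recovers c from v ([fourier_expands]) and gives Parseval's
    identity ([inner_expands]); the fractional Laplacian and the first partial
    derivative act on coefficients as the multipliers |k|^beta and i k_1
    ([fracLap_expands], [pd1_expands]).  Since i k_1 is imaginary and odd, the
    derivative is skew-adjoint, while the real multiplier |k|^beta is self-adjoint
    and commutes with it.

    Conservation then comes from a choice of test function at a fixed time.
    - Mass: v = 1, whose derivative vanishes.
    - Momentum: v = u.  The dispersive term vanishes by skew-adjointness, and so
      does the convective one, because the integral of u^2 du/dx_1 equals minus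
      twice itself.
    - Energy: with w = (-Delta)^(alpha/2) u - u^2/2, the L^2 gradient of H at u, the
      scheme reads (du/dt, v) = - (w, dv/dx_1) and dH/dt = (w, du/dt).  Because w
      contains u^2, it need not lie in X_N, so the test function is its orthogonal
      projection p on X_N ([proj_expands]): du/dt and dp/dx_1 belong to X_N, hence
      (w, du/dt) = (p, du/dt) = - (w, dp/dx_1) = - (p, dp/dx_1) = 0.

    There remains the differentiation of the functionals in time.  Convergence of
    difference quotients in L^2 forces that of each Fourier coefficient
    ([coef_le_L2norm]), so the curve u is a finite sum of scalar differentiable
    functions of time multiplied by fixed bounded functions of space.  Such curves
    ([curve_diff]) are stable under products and may be differentiated under the
    integral over Omega, which is all that the quadratic and cubic functionals
    require. *)

Set Implicit Arguments.
Unset Strict Implicit.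
Unset Printing Implicit Defensive.

Import Order.TTheory GRing.Theory Num.Theory numFieldNormedType.Exports.

Local Open Scope classical_set_scope.
Local Open Scope ring_scope.
Local Open Scope complex_scope.

(** * Integrals of sines and cosines over one period *)

Section one_period.
Context {R : realType}.
Notation mu := (@lebesgue_measure R).

Lemma sin_int_pi (m : int) : sin (m%:~R * pi : R) = 0.
Proof.
have H (n : nat) : sin (n%:R * pi : R) = 0.
  elim: n => [|n IHn]; first by rewrite mul0r sin0.
  by rewrite -natr1 mulrDl mul1r sinDpi IHn oppr0.
case: m => n; first exact: H.
by rewrite NegzE mulrNz mulNr sinN -pmulrn H oppr0.
Qed.

Let cvf (f : R -> R) : (forall x : R, derivable f x 1) -> continuous f.
Proof. by move=> df x; apply: differentiable_continuous; exact/derivable1_diffP. Qed.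

Lemma Rintegral_period_derive (f F : R -> R) :
  (forall x : R, is_derive x 1 F (f x)) -> continuous f -> F pi = F (- pi) ->
  \int[mu]_(x in `[- pi, pi]) f x = 0.
Proof.
move=> dF cf FE; have cF : continuous F by apply: cvf => x; exact: ex_derive.
rewrite /Rintegral (@continuous_FTC2 _ f F).
- by rewrite FE -EFinB subrr.
- by rewrite gtrN// pi_gt0.
- exact: continuous_subspaceT.
- split; first by move=> x _; exact: ex_derive.
  + by apply: cvg_at_right_filter; exact: cF.
  + by apply: cvg_at_left_filter; exact: cF.
- by move=> x _; rewrite derive1E derive_val.
Qed.

Let is_derive_scale (c m x g : R) (G : R -> R) : is_derive (m * x) 1 G g ->
  is_derive x 1 (fun y => c * G (m * y)) (c * (m * g)).
Proof.
move=> dG.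
have dm : is_derive x 1 (m \*: (@id R)) m.
  by apply: is_derive_eq; rewrite /GRing.scale /= mulr1.
have := @is_derive1_comp _ G (m \*: (@id R)) x g m dG dm.
move=> dC; have := is_deriveZ c dC.
by rewrite /GRing.scale /= (mulrC g).
Qed.

Lemma Rintegral_sin_period (m : int) :
  \int[mu]_(x in `[- pi, pi]) sin (m%:~R * x) = 0.
Proof.
have [->|m0] := eqVneq m 0.
  under eq_Rintegral do rewrite mul0r sin0.
  by rewrite Rintegral_cst ?mul0r.
have m0' : m%:~R != 0 :> R by rewrite intr_eq0.
apply: (@Rintegral_period_derive _ (fun x => - (m%:~R)^-1 * cos (m%:~R * x))).
- move=> x; have D := is_derive_scale (- m%:~R^-1) (is_derive_cos (m%:~R * x)).
  by apply: is_derive_eq; field.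
- by move=> x; apply: continuous_comp; [exact: mulrl_continuous|exact: continuous_sin].
- by rewrite mulrN cosN.
Qed.

Lemma Rintegral_cos_period (m : int) :
  \int[mu]_(x in `[- pi, pi]) cos (m%:~R * x) = if m == 0 then pi *+ 2 else 0.
Proof.
have [->|m0] := eqVneq m 0.
  under eq_Rintegral do rewrite mul0r cos0.
  have -> : \int[mu]_(x in `[- pi, pi]) (1 : R) = fine (mu `[- pi, pi]%classic).
    by rewrite Rintegral_cst // mul1r.
  by rewrite lebesgue_measure_itv /= lte_fin gtrN ?pi_gt0// -EFinB opprK.
have m0' : m%:~R != 0 :> R by rewrite intr_eq0.
apply: (@Rintegral_period_derive _ (fun x => (m%:~R)^-1 * sin (m%:~R * x))).
- move=> x; have D := is_derive_scale m%:~R^-1 (is_derive_sin (m%:~R * x)).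
  by apply: is_derive_eq; field.
- by move=> x; apply: continuous_comp; [exact: mulrl_continuous|exact: continuous_cos].
- by rewrite mulrN sinN sin_int_pi oppr0.
Qed.

End one_period.

(** * Integration of bounded measurable functions over Omega *)

Section integrals_over_Omega.
Context {R : realType}.
Notation mu := (@lebesgue_measure R).
Notation plane := (measurableTypeR R * measurableTypeR R)%type.
Implicit Types (f g h : R * R -> R).

(** On the finite measure space Omega this class consists of integrable functions
    and, unlike integrability itself, it is stable under products. *)
Definition bmeas f :=
  measurable_fun [set: plane] (f : plane -> R) /\ exists M, forall x, `|f x| <= M.

Lemma bmeas_cst (c : R) : bmeas (fun=> c).
Proof. by split; [exact: measurable_cst|exists `|c|]. Qed.

Lemma bmeasD f g : bmeas f -> bmeas g -> bmeas (fun x => f x + g x).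
Proof.
move=> [mf [M fM]] [mg [K gK]]; split; first exact: measurable_funD.
by exists (M + K) => x; rewrite (le_trans (ler_normD _ _))// lerD.
Qed.

Lemma bmeasM f g : bmeas f -> bmeas g -> bmeas (fun x => f x * g x).
Proof.
move=> [mf [M fM]] [mg [K gK]]; split; first exact: measurable_funM.
by exists (M * K) => x; rewrite normrM ler_pM.
Qed.

Lemma bmeas_sum (I : Type) (r : seq I) (F : I -> R * R -> R) :
  (forall i, bmeas (F i)) -> bmeas (fun x => \sum_(i <- r) F i x).
Proof.
move=> bF; elim: r => [|i r IHr].
  by under eq_fun do rewrite big_nil; exact: bmeas_cst.
by under eq_fun do rewrite big_cons; exact: bmeasD.
Qed.

Lemma bmeas_trig (h : R -> R) (k : int * int) : continuous h ->
  (forall t, `|h t| <= 1) -> bmeas (fun x => h (dotk k x)).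
Proof.
move=> ch h1; split; last by exists 1.
apply: (@measurableT_comp _ _ _ _ _ _ h); first exact: continuous_measurable_fun.
by apply: measurable_funD; apply: measurable_funM.
Qed.

Lemma measurable_Omega : measurable (Omega : set plane).
Proof. by apply: measurableX. Qed.

Lemma Omega_fin : (leb2 (Omega : set plane) < +oo)%E.
Proof.
pose I : set R := `[- pi, pi]%classic.
have -> : leb2 (Omega : set plane) = (mu I * mu I)%E.
  exact: product_measure1E.
by rewrite /I lebesgue_measure_itv /=; case: ifP; rewrite ?mule0 // ltey.
Qed.

Lemma bmeas_integrable f : bmeas f -> leb2.-integrable (Omega : set plane) (EFin \o f).
Proof.
move=> [mf [M fM]]; apply: measurable_bounded_integrable.
- exact: measurable_Omega.
- exact: Omega_fin.
- exact: measurable_funTS.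
- by exists M; split; [exact: num_real|move=> y My x _; exact: le_trans (fM x) (ltW My)].
Qed.

Lemma intOmegaD f g : bmeas f -> bmeas g ->
  intOmega (fun x => f x + g x) = intOmega f + intOmega g.
Proof.
by move=> bf bg; rewrite /intOmega RintegralD//; [exact: measurable_Omega
  |exact: bmeas_integrable..].
Qed.

Lemma intOmegaZ (c : R) f : bmeas f -> intOmega (fun x => c * f x) = c * intOmega f.
Proof.
by move=> bf; rewrite /intOmega RintegralZl//; [exact: measurable_Omega
  |exact: bmeas_integrable].
Qed.

Lemma intOmega_sum (I : Type) (r : seq I) (F : I -> R * R -> R) :
  (forall i, bmeas (F i)) ->
  intOmega (fun x => \sum_(i <- r) F i x) = \sum_(i <- r) intOmega (F i).
Proof.
move=> bF; elim: r => [|i r IHr].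
  rewrite big_nil -[RHS](mul0r (intOmega (fun=> 0))) -intOmegaZ; last exact: bmeas_cst.
  by congr intOmega; apply/funext => x; rewrite big_nil mul0r.
rewrite big_cons -IHr -intOmegaD //; last exact: bmeas_sum.
by congr intOmega; apply/funext => x; rewrite big_cons.
Qed.

Lemma innerZl (c : R) f g : bmeas f -> bmeas g ->
  inner (fun x => c * f x) g = c * inner f g.
Proof.
move=> bf bg; rewrite -intOmegaZ; last exact: bmeasM.
by congr intOmega; apply/funext => x; rewrite mulrA.
Qed.

Lemma innerDl f g h : bmeas f -> bmeas g -> bmeas h ->
  inner (fun x => f x + g x) h = inner f h + inner g h.
Proof.
move=> bf bg bh; rewrite -intOmegaD; [|exact: bmeasM|exact: bmeasM].
by congr intOmega; apply/funext => x; rewrite mulrDl.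
Qed.

Lemma innerC f g : inner f g = inner g f.
Proof. by congr intOmega; apply/funext => x; rewrite mulrC. Qed.

(** Fubini, the restriction to Omega being carried by the integrand: extended by
    zero, h1 (x.1) * h2 (x.2) has inner integral h1 (x.1) times a constant on the
    interval and zero outside. *)
Lemma intOmega_prod (h1 h2 : R -> R) : continuous h1 -> continuous h2 ->
  (forall t, `|h1 t| <= 1) -> (forall t, `|h2 t| <= 1) ->
  intOmega (fun x => h1 x.1 * h2 x.2) =
  (\int[mu]_(x in `[- pi, pi]) h1 x) * (\int[mu]_(x in `[- pi, pi]) h2 x).
Proof.
move=> c1 c2 b1 b2.
have iD (h : R -> R) : continuous h -> (forall t, `|h t| <= 1) ->
    mu.-integrable `[- pi, pi] (EFin \o h).
  move=> ch h1'; apply: continuous_compact_integrable; first exact: segment_compact.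
  exact: continuous_subspaceT.
have bh : bmeas (fun x => h1 x.1 * h2 x.2).
  apply: bmeasM; split; try by exists 1.
  - by apply: (@measurableT_comp _ _ _ _ _ _ h1); first exact: continuous_measurable_fun.
  - by apply: (@measurableT_comp _ _ _ _ _ _ h2); first exact: continuous_measurable_fun.
rewrite /intOmega Rintegral_mkcond /Rintegral.
have := bmeas_integrable bh.
rewrite (integrable_mkcond _ measurable_Omega) => ih.
pose h (x : plane) : R := h1 x.1 * h2 x.2.
have -> : (fun x => ((h \_ Omega) x)%:E) = ((EFin \o h) \_ Omega)%E.
  by apply/funext => x; rewrite /patch; case: ifP.
rewrite -(integral12_prod_meas1 ih) /fubini_F -/h.
pose I1 : set R := `[- pi, pi]%classic.
pose I2 := \int[mu]_(x in I1) h2 x.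
pose h1I (x : R) : R := h1 x * I2.
have E2 x : (\int[mu]_y ((EFin \o h) \_ Omega) (x, y) = ((h1I \_ I1) x)%:E)%E.
  rewrite [X in _ = X%:E]/patch.
  case: ifPn => [xp|xp]; last first.
    rewrite -[RHS](integral0 mu [set: R]); apply: eq_integral => y _.
    rewrite /patch ifF//; apply/negbTE; move: xp; apply: contra.
    by rewrite !inE /Omega => -[].
  rewrite EFinM /I2 /Rintegral fineK; last first.
    by apply: integrable_fin_num; [exact: measurable_itv|exact: (iD _ c2 b2)].
  rewrite -integralZl; [|exact: measurable_itv|exact: (iD _ c2 b2)].
  rewrite [RHS]integral_mkcond; apply: eq_integral => y _.
  rewrite /patch /=; congr (if _ then _ else _).
  rewrite /Omega; apply/idP/idP; rewrite !inE /=; first by case.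
  by move: xp; rewrite inE.
transitivity (Rintegral mu [set: R] (h1I \_ I1)).
  by congr fine; apply: eq_integral => x _; exact: E2.
rewrite -Rintegral_mkcond.
by rewrite -RintegralZr; [|exact: measurable_itv|exact: (iD _ c1 b1)].
Qed.

End integrals_over_Omega.

(** * Fourier coefficients of trigonometric polynomials *)

Section trigonometric_polynomials.
Context {R : realType}.
Implicit Types (f v w : R * R -> R) (g : R * R -> R[i]) 
  (k l : int * int) (c d : int * int -> R[i]).

Let sq2pi : R := (pi *+ 2) ^+ 2.

Let sq2pi_neq0 : sq2pi != 0.
Proof. by rewrite expf_eq0 /= mulrn_eq0 /= gt_eqF ?pi_gt0. Qed.

Lemma expiD (a b : R) : expi (a + b) = expi a * expi b.
Proof.
rewrite /expi cosD sinD; apply/eqP; rewrite eq_complex /=.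
by rewrite eqxx /= addrC (mulrC (sin a)) eqxx.
Qed.

Lemma expiN (a : R) : expi (- a) = (expi a)^*.
Proof. by rewrite /expi cosN sinN. Qed.

Lemma dotkD k l (x : R * R) : dotk (k + l) x = dotk k x + dotk l x.
Proof. by rewrite /dotk /= !intrD; ring. Qed.

Lemma dotkN k (x : R * R) : dotk (- k) x = - dotk k x.
Proof. by rewrite /dotk /= !mulrNz; ring. Qed.

Definition cbmeas g := bmeas (fun x => complex.Re (g x)) /\ bmeas (fun x => complex.Im (g x)).

Lemma ReD (a b : R[i]) : complex.Re (a + b) = complex.Re a + complex.Re b.
Proof. by case: a; case: b. Qed.
Lemma ImD (a b : R[i]) : complex.Im (a + b) = complex.Im a + complex.Im b.
Proof. by case: a; case: b. Qed.
(** The factor -1 keeps the right-hand side a sum of products, the form in which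
   [bmeasD], [bmeasM] and [intOmegaD] apply. *)
Lemma ReM (a b : R[i]) : complex.Re (a * b) =
  complex.Re a * complex.Re b + (- 1) * (complex.Im a * complex.Im b).
Proof. by rewrite mulN1r; case: a; case: b. Qed.
Lemma ImM (a b : R[i]) : complex.Im (a * b) =
  complex.Re a * complex.Im b + complex.Im a * complex.Re b.
Proof. by case: a; case: b. Qed.

Lemma Re_sum (I : Type) (r : seq I) (F : I -> R[i]) :
  complex.Re (\sum_(i <- r) F i) = \sum_(i <- r) complex.Re (F i).
Proof. by rewrite (big_morph _ ReD (erefl _)). Qed.

Lemma Im_sum (I : Type) (r : seq I) (F : I -> R[i]) :
  complex.Im (\sum_(i <- r) F i) = \sum_(i <- r) complex.Im (F i).
Proof. by rewrite (big_morph _ ImD (erefl _)). Qed.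

Lemma complex_eqP (a b : R[i]) :
  complex.Re a = complex.Re b -> complex.Im a = complex.Im b -> a = b.
Proof. by case: a => ? ?; case: b => ? ? /= -> ->. Qed.

Lemma cbmeas_cst (z : R[i]) : cbmeas (fun=> z).
Proof. by split; exact: bmeas_cst. Qed.

Lemma cbmeasM g1 g2 : cbmeas g1 -> cbmeas g2 -> cbmeas (fun x => g1 x * g2 x).
Proof.
move=> [r1 i1] [r2 i2]; split.
  under eq_fun do rewrite ReM; apply: bmeasD; first exact: bmeasM.
  by apply: bmeasM; [exact: bmeas_cst|exact: bmeasM].
by under eq_fun do rewrite ImM; apply: bmeasD; exact: bmeasM.
Qed.

Lemma cbmeas_expi k : cbmeas (fun x => expi (dotk k x)).
Proof.
split; apply: bmeas_trig; [exact: continuous_cos|exact: cos_max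
  |exact: continuous_sin|exact: sin_max].
Qed.

Lemma cbmeas_real f : bmeas f -> cbmeas (fun x => (f x)%:C).
Proof. by move=> bf; split => //=; exact: bmeas_cst. Qed.

Lemma cintOmegaZ (z : R[i]) g : cbmeas g ->
  cintOmega (fun x => z * g x) = z * cintOmega g.
Proof.
have bz (a : R) h : bmeas h -> bmeas (fun x => a * h x).
  by move=> bh; apply: bmeasM => //; exact: bmeas_cst.
move=> [r1 i1]; apply: complex_eqP; rewrite ?ReM ?ImM /=.
  rewrite -!intOmegaZ//; last exact: bz.
  rewrite -intOmegaD//; [|exact: bz|exact/bz/bz].
  by congr intOmega; apply/funext => x; rewrite ReM.
rewrite -!intOmegaZ// -intOmegaD//; [|exact: bz|exact: bz].
by congr intOmega; apply/funext => x; rewrite ImM.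
Qed.

Lemma cintOmega_real f : cintOmega (fun x => (f x)%:C) = (intOmega f)%:C.
Proof.
rewrite /cintOmega /=; congr (_ +i* _).
rewrite -[RHS](mul0r (intOmega (fun=> 0))) -intOmegaZ; last exact: bmeas_cst.
by congr intOmega; apply/funext => x; rewrite mul0r.
Qed.

Lemma cintOmega_sum (I : Type) (r : seq I) (F : I -> R * R -> R[i]) :
  (forall i, cbmeas (F i)) ->
  cintOmega (fun x => \sum_(i <- r) F i x) = \sum_(i <- r) cintOmega (F i).
Proof.
move=> bF; apply: complex_eqP; rewrite ?Re_sum ?Im_sum /= -intOmega_sum.
- by congr intOmega; apply/funext => x; rewrite Re_sum.
- by move=> i; case: (bF i).
- by congr intOmega; apply/funext => x; rewrite Im_sum.
- by move=> i; case: (bF i).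
Qed.

(** Orthogonality of the exponentials: by the addition formulas the integral is
    made of products of one-dimensional integrals, and those of sines vanish. *)
Lemma cintOmega_expi k :
  cintOmega (fun x => expi (dotk k x)) = if k == 0 then sq2pi%:C else 0.
Proof.
have cc (m : int) : continuous (fun t : R => cos (m%:~R * t)).
  by move=> x; apply: continuous_comp; [exact: mulrl_continuous|exact: continuous_cos].
have cs (m : int) : continuous (fun t : R => sin (m%:~R * t)).
  by move=> x; apply: continuous_comp; [exact: mulrl_continuous|exact: continuous_sin].
have bprod (h1 h2 : R -> R) (a b : int) : continuous h1 -> continuous h2 ->
    (forall t, `|h1 t| <= 1) -> (forall t, `|h2 t| <= 1) ->
    bmeas (fun x : R * R => h1 (a%:~R * x.1) * h2 (b%:~R * x.2)).
  move=> c1 c2 n1 n2.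
  have -> : (fun x : R * R => h1 (a%:~R * x.1) * h2 (b%:~R * x.2)) =
    (fun x => h1 (dotk (a, 0) x) * h2 (dotk (0, b) x)).
    by apply/funext => x; rewrite /dotk /= !mul0r addr0 add0r.
  by apply: bmeasM; apply: bmeas_trig.
have [bcc bss bsc bcs] : [/\
   bmeas (fun x : R * R => cos (k.1%:~R * x.1) * cos (k.2%:~R * x.2)),
   bmeas (fun x : R * R => sin (k.1%:~R * x.1) * sin (k.2%:~R * x.2)),
   bmeas (fun x : R * R => sin (k.1%:~R * x.1) * cos (k.2%:~R * x.2)) &
   bmeas (fun x : R * R => cos (k.1%:~R * x.1) * sin (k.2%:~R * x.2))].
  by split; apply: bprod => //; (exact: continuous_cos || exact: continuous_sin
     || exact: cos_max || exact: sin_max).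
have P (h1 h2 : R -> R) (a b : int) :
    continuous (fun t : R => h1 (a%:~R * t)) ->
    continuous (fun t : R => h2 (b%:~R * t)) ->
    (forall t, `|h1 t| <= 1) -> (forall t, `|h2 t| <= 1) ->
  intOmega (fun x => h1 (a%:~R * x.1) * h2 (b%:~R * x.2)) =
    (\int[lebesgue_measure]_(x in `[- pi, pi]) h1 (a%:~R * x)) *
    (\int[lebesgue_measure]_(x in `[- pi, pi]) h2 (b%:~R * x)).
  move=> c1 c2 n1 n2.
  exact: (@intOmega_prod R (fun t : R => h1 (a%:~R * t)) (fun t : R => h2 (b%:~R * t))).
have [cm sm] := (@cos_max R, @sin_max R).
rewrite /cintOmega /expi /=.
pose per (m : int) : R := if m == 0 then pi *+ 2 else 0.
have -> : intOmega (fun x : R * R => cos (dotk k x)) = per k.1 * per k.2.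
  rewrite /per -!Rintegral_cos_period -P//.
  have -> : (fun x : R * R => cos (dotk k x)) =
    (fun x => cos (k.1%:~R * x.1) * cos (k.2%:~R * x.2)
     + (-1) * (sin (k.1%:~R * x.1) * sin (k.2%:~R * x.2))).
    by apply/funext => x; rewrite /dotk cosD mulN1r.
  rewrite intOmegaD//; last by apply: bmeasM => //; exact: bmeas_cst.
  by rewrite intOmegaZ// [X in _ + _ * X]P// Rintegral_sin_period mul0r mulr0 addr0.
have -> : intOmega (fun x : R * R => sin (dotk k x)) = 0.
  have -> : (fun x : R * R => sin (dotk k x)) =
    (fun x => sin (k.1%:~R * x.1) * cos (k.2%:~R * x.2)
     + cos (k.1%:~R * x.1) * sin (k.2%:~R * x.2)).
    by apply/funext => x; rewrite /dotk sinD.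
  by rewrite intOmegaD// !P// !Rintegral_sin_period mul0r mulr0 addr0.
case: k {bcc bss bsc bcs} => a b /=; rewrite /per.
have -> : ((a, b) == 0) = (a == 0) && (b == 0) by [].
by case: eqP => _; case: eqP => _; rewrite ?mul0r ?mulr0.
Qed.

Definition expands c (M : nat) v :=
  forall x, (v x)%:C = \sum_(k <- freqs M) c k * expi (dotk k x).

Lemma expands_bmeas c M v : expands c M v -> bmeas v.
Proof.
move=> cv; have -> : v = (fun x => \sum_(k <- freqs M) complex.Re (c k * expi (dotk k x))).
  by apply/funext => x; rewrite -Re_sum -cv.
apply: bmeas_sum => k.
by case: (cbmeasM (cbmeas_cst (c k)) (cbmeas_expi k)).
Qed.

Lemma cintOmega_fourier f k :
  cintOmega (fun x => (f x)%:C * expi (- dotk k x)) = sq2pi%:C * fourier f k.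
Proof.
by rewrite /fourier mulrA -rmorphM /= mulfV // mul1r.
Qed.

(** The zero branch matters as well: it makes the square partial sums that define
    the fractional Laplacian stationary from rank M on. *)
Lemma fourier_expands c M v k : expands c M v ->
  fourier v k = if k \in freqs M then c k else 0.
Proof.
move=> cv; apply: (@mulfI _ sq2pi%:C); first by rewrite eq_complex /= negb_and sq2pi_neq0.
rewrite -cintOmega_fourier.
have -> : (fun x => (v x)%:C * expi (- dotk k x)) =
    (fun x => \sum_(l <- freqs M) c l * expi (dotk (l - k) x)).
  apply/funext => x; rewrite cv mulr_suml; apply: eq_bigr => l _.
  by rewrite dotkD dotkN expiD mulrA.
rewrite cintOmega_sum; last by move=> l; apply: cbmeasM; [exact: cbmeas_cst|exact: cbmeas_expi].
transitivity (\sum_(l <- freqs M) c l * (if l == k then sq2pi%:C else 0)).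
  apply: eq_bigr => l _; rewrite cintOmegaZ ?cintOmega_expi ?subr_eq0//.
  exact: cbmeas_expi.
case: ifPn => [kM|kM].
  rewrite (bigD1_seq k) ?freqs_uniq//= eqxx mulrC big1 ?addr0// => l /negbTE ->.
  by rewrite mulr0.
rewrite mulr0 big_seq big1 // => l lM; case: eqP => [E|]; last by rewrite mulr0.
by rewrite -E lM in kM.
Qed.

(** Parseval's identity with only one factor a trigonometric polynomial: w being
    real, it equals its own conjugate, so integrating f against it picks the Fourier
    coefficients of f.  The asymmetry is what allows f = u^2, which has frequencies
    beyond N. *)
Lemma inner_expands f d M w : bmeas f -> expands d M w ->
  (inner f w)%:C = sq2pi%:C * \sum_(k <- freqs M) fourier f k * (d k)^*.
Proof.
move=> bf dw; rewrite /inner -cintOmega_real.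
have -> : (fun x => (f x * w x)%:C) =
  (fun x => \sum_(k <- freqs M) (d k)^* * ((f x)%:C * expi (- dotk k x))).
  apply/funext => x; rewrite rmorphM /= -[X in _ * X]conjc_real dw rmorph_sum mulr_sumr.
  by apply: eq_bigr => k _; rewrite rmorphM /= expiN mulrCA.
have be k : cbmeas (fun x => (f x)%:C * expi (- dotk k x)).
  under eq_fun do rewrite -dotkN.
  by apply: cbmeasM; [exact: cbmeas_real|exact: cbmeas_expi].
rewrite cintOmega_sum; last by move=> k; apply: cbmeasM => //; exact: cbmeas_cst.
rewrite mulr_sumr; apply: eq_bigr => k _.
by rewrite cintOmegaZ// cintOmega_fourier mulrC mulrA.
Qed.

End trigonometric_polynomials.

(** * Multipliers, products and projection *)

Section multipliers.
Context {R : realType}.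
Implicit Types (f v w : R * R -> R) (k l : int * int) (c d : int * int -> R[i]).

Lemma XN_expands (N : nat) v : XN N v -> expands (fourier v) N v.
Proof.
move=> [c cv] x; rewrite cv big_seq [RHS]big_seq; apply: eq_bigr => k kN.
by rewrite (fourier_expands k (cv : expands c N v)) kN.
Qed.

Lemma freqs_filter (M K : nat) : (M <= K)%N ->
  perm_eq [seq k <- freqs K | k \in freqs M] (freqs M).
Proof.
move=> MK; apply: uniq_perm; rewrite ?filter_uniq ?freqs_uniq// => k.
rewrite mem_filter; case kM: (k \in freqs M) => //=.
by rewrite mem_freqs (leq_trans _ MK)// -mem_freqs.
Qed.

Lemma fracLap_expands (beta : R) c (M : nat) v : expands c M v ->
  expands (fun k => (normk k `^ beta)%:C * c k) M (fracLap beta v).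
Proof.
move=> cv x; set S := RHS.
have psumE K : (M <= K)%N -> fracLap_psum beta v K x = S.
  move=> MK; rewrite /S -(perm_big _ (freqs_filter MK)) big_filter /=.
  rewrite big_mkcond; apply: eq_bigr => k _.
  by rewrite (fourier_expands _ cv); case: ifP; rewrite // mulr0 mul0r.
have -> : fracLap beta v x = complex.Re S.
  apply: cvg_lim => //; apply: cvg_near_cst.
  by exists M => // K /= MK; rewrite psumE.
have := fracLap_psum_real beta v M x; rewrite psumE//.
by case: S {psumE} => a b /= ->.
Qed.

(** Reduces a directional derivative on the plane to the one-variable calculus. *)
Lemma is_derive_along (f : R * R -> R) (x v : R * R) (l : R) :
  is_derive (0 : R) (1 : R) (fun t : R => f (t *: v + x)) l -> is_derive x v f l.
Proof.
have E : (fun h : R => h^-1 *: ((f \o shift x) (h *: v) - f x)) =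
  (fun h : R =>
     h^-1 *: (((fun t : R => f (t *: v + x)) \o shift 0) (h *: 1) - f (0 *: v + x))).
  by apply/funext => h; rewrite /= addr0 scale0r add0r /GRing.scale /= mulr1.
move=> [df dl]; apply: DeriveDef; first by rewrite /derivable E.
by rewrite /derive E.
Qed.

Lemma is_derive_trig k (x : R * R) (h : R -> R) (dh : R) :
  is_derive (dotk k x) (1 : R) h dh ->
  is_derive x (1, 0) (fun y => h (dotk k y)) (k.1%:~R * dh).
Proof.
move=> D; apply: is_derive_along.
have -> : (fun t : R => h (dotk k (t *: (1, 0) + x))) =
  h \o (fun t : R => k.1%:~R * t + dotk k x).
  apply/funext => t /=; congr h.
  by rewrite -[LHS]/(k.1%:~R * (t * 1 + x.1) + k.2%:~R * (t * 0 + x.2)) /dotk; ring.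
rewrite mulrC; apply: is_derive1_comp; first by rewrite mulr0 add0r.
have D1 : is_derive (0 : R) 1 (k.1%:~R \*: (@id R)) (k.1%:~R).
  by apply: is_derive_eq; rewrite /GRing.scale /= mulr1.
have := is_deriveD D1 (is_derive_cst (dotk k x) (0 : R) (1 : R)).
by rewrite addr0.
Qed.

Lemma is_derive_sum_seq (I : Type) (r : seq I) (F : I -> R * R -> R) (dF : I -> R)
    (x v : R * R) : (forall i, is_derive x v (F i) (dF i)) ->
  is_derive x v (fun y => \sum_(i <- r) F i y) (\sum_(i <- r) dF i).
Proof.
move=> D; elim: r => [|i r IHr].
  rewrite big_nil; under eq_fun do rewrite big_nil; exact: is_derive_cst.
by rewrite big_cons; under eq_fun do rewrite big_cons; exact: is_deriveD.
Qed.

Lemma is_derive_trigpoly c (M : nat) (x : R * R) :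
  is_derive x (1, 0) (fun y => complex.Re (\sum_(k <- freqs M) c k * expi (dotk k y)))
    (complex.Re (\sum_(k <- freqs M) 'i * k.1%:~R%:C * c k * expi (dotk k x))).
Proof.
have -> : (fun y => complex.Re (\sum_(k <- freqs M) c k * expi (dotk k y))) =
  fun y => \sum_(k <- freqs M)
    (complex.Re (c k) * cos (dotk k y) + (- complex.Im (c k)) * sin (dotk k y)).
  by apply/funext => y; rewrite Re_sum; apply: eq_bigr => k _; rewrite ReM /=; ring.
rewrite Re_sum; apply: is_derive_sum_seq => k.
have D1 := is_deriveZ (complex.Re (c k)) (is_derive_trig (is_derive_cos (dotk k x))).
have D2 := is_deriveZ (- complex.Im (c k)) (is_derive_trig (is_derive_sin (dotk k x))).
apply: is_derive_eq; rewrite /GRing.scale /=; case: (c k) => a b /=; ring.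
Qed.

Lemma expands_is_derive c (M : nat) v (x : R * R) : expands c M v ->
  is_derive x (1, 0) v
    (complex.Re (\sum_(k <- freqs M) 'i * k.1%:~R%:C * c k * expi (dotk k x))).
Proof.
move=> cv; have -> : v = fun y => complex.Re (\sum_(k <- freqs M) c k * expi (dotk k y)).
  by apply/funext => y; rewrite -cv.
exact: is_derive_trigpoly.
Qed.

(** [is_derive_trigpoly] gives only the real part of the claim.  The imaginary part
    of sum c_k e_k is the real part of sum (-i c_k) e_k; it is identically zero,
    hence so is its derivative, which is the imaginary part of sum i k_1 c_k e_k. *)
Lemma pd1_expands c (M : nat) v : expands c M v ->
  expands (fun k => 'i * k.1%:~R%:C * c k) M (pd1 v).
Proof.
move=> cv x; have D := expands_is_derive x cv.
rewrite /pd1 derive_val; apply: complex_eqP => //=.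
have := is_derive_trigpoly (fun k => - 'i * c k) M x.
have -> : (fun y => complex.Re (\sum_(k <- freqs M) - 'i * c k * expi (dotk k y))) = cst 0.
  apply/funext => y; under eq_bigr do rewrite -mulrA; rewrite -mulr_sumr -cv ReM /=.
  by ring.
move=> D0; have := @derive_val _ _ _ _ _ _ _ D0.
rewrite derive_cst => ->.
rewrite Im_sum Re_sum; apply: eq_bigr => k _.
have -> : 'i * (k.1%:~R)%:C * (- 'i * c k) * expi (dotk k x) =
  - 'i * ('i * (k.1%:~R)%:C * c k * expi (dotk k x)) by ring.
by rewrite [LHS]ReM /=; ring.
Qed.

Lemma expandsM c d (M K : nat) v w : expands c M v -> expands d K w ->
  exists e, expands e (M + K)%N (fun x => v x * w x).
Proof.
move=> cv dw.
exists (fun m => \sum_(k <- freqs M) \sum_(l <- freqs K | k + l == m) c k * d l) => x.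
rewrite rmorphM /= cv dw mulr_suml.
under [RHS]eq_bigr do rewrite mulr_suml.
rewrite [RHS]exchange_big /= big_seq [RHS]big_seq; apply: eq_bigr => k kM.
under [RHS]eq_bigr do rewrite mulr_suml big_mkcond.
rewrite mulr_sumr [RHS]exchange_big /= big_seq [RHS]big_seq; apply: eq_bigr => l lK.
have klMK : k + l \in freqs (M + K).
  by move: kM lK; rewrite !mem_freqs !geq_max; case: k => ? ?; case: l => ? ? /=; lia.
rewrite (bigD1_seq (k + l)) ?freqs_uniq//= eqxx big1 ?addr0.
  by rewrite dotkD expiD mulrACA.
by move=> m; rewrite eq_sym => /negbTE ->.
Qed.

(** Each coefficient is at most the L^2 norm: by Parseval (v, v) is (2 pi)^2 times
    the sum of the |c_k|^2.  This is the only equivalence of norms on X_N that time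
    differentiation needs. *)
Lemma coef_le_L2norm c (N : nat) v k : expands c N v -> k \in freqs N ->
  `|complex.Re (c k)| <= L2norm v /\ `|complex.Im (c k)| <= L2norm v.
Proof.
move=> cv kN.
have E : inner v v = (pi *+ 2) ^+ 2 *
    \sum_(k <- freqs N) (complex.Re (c k) ^+ 2 + complex.Im (c k) ^+ 2).
  rewrite -[LHS]/(complex.Re (inner v v)%:C).
  rewrite (inner_expands (expands_bmeas cv) cv) ReM /= mul0r mulr0 addr0 Re_sum.
  congr (_ * _); rewrite big_seq [RHS]big_seq; apply: eq_bigr => l lN.
  by rewrite (fourier_expands _ cv) lN; case: (c l) => a b /=; ring.
have ge0 (l : int * int) : 0 <= complex.Re (c l) ^+ 2 + complex.Im (c l) ^+ 2.
  by rewrite addr_ge0 ?sqr_ge0.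
have le : complex.Re (c k) ^+ 2 + complex.Im (c k) ^+ 2 <= inner v v.
  rewrite E (bigD1_seq k) ?freqs_uniq//=.
  have S0 : 0 <= \sum_(i <- freqs N | i != k) (complex.Re (c i) ^+ 2 + complex.Im (c i) ^+ 2).
    exact: sumr_ge0.
  have p2 := @pi_ge2 R.
  have : 1 <= (pi *+ 2 : R) ^+ 2 by rewrite exprn_ege1// mulr2n; lra.
  have := ge0 k; nra.
have sq (a b : R) : a ^+ 2 + b ^+ 2 <= inner v v -> `|a| <= L2norm v.
  by move=> ab; rewrite -sqrtr_sqr ler_wsqrtr//; have := sqr_ge0 b; lra.
by split; [apply: sq le|apply: (sq _ (complex.Re (c k))); rewrite addrC].
Qed.

Lemma inner_pd1_skew c d (M K : nat) v w : expands c M v -> expands d K w ->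
  inner v (pd1 w) = - inner (pd1 v) w.
Proof.
move=> cv dw; apply: complexI; rewrite rmorphN /=.
have bv := expands_bmeas cv; have bv' := expands_bmeas (pd1_expands cv).
rewrite (inner_expands bv (pd1_expands dw)) (inner_expands bv' dw).
rewrite -mulrN -sumrN; congr (_ * _); apply: eq_bigr => k _.
rewrite (fourier_expands _ cv) (fourier_expands _ (pd1_expands cv)).
case: ifP => _; last by rewrite !mul0r oppr0.
by apply: complex_eqP; case: (c k) => a b; case: (d k) => a' b' /=; ring.
Qed.

(** Each term |k|^beta c_k conj (i k_1 c_k) of the Parseval sum is purely
    imaginary, whereas the inner product is real. *)
Lemma inner_fracLap_pd1 (beta : R) c (M : nat) v : expands c M v ->
  inner (fracLap beta v) (pd1 v) = 0.
Proof.
move=> cv; have fv := fracLap_expands beta cv.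
have -> : inner (fracLap beta v) (pd1 v) = complex.Re ((inner (fracLap beta v) (pd1 v))%:C) by [].
rewrite (inner_expands (expands_bmeas fv) (pd1_expands cv)).
rewrite ReM /= mul0r mulr0 addr0 Re_sum big1 ?mulr0// => k _.
rewrite (fourier_expands _ fv); case: ifP => _; last by rewrite mul0r.
by case: (c k) => a b /=; ring.
Qed.

Lemma inner_fracLap_half (alpha : R) c d (M : nat) v w :
  expands c M v -> expands d M w ->
  inner (fracLap (alpha / 2) v) (fracLap (alpha / 2) w) = inner (fracLap alpha v) w.
Proof.
move=> cv dw; apply: complexI.
have hv := fracLap_expands (alpha / 2) cv; have fv := fracLap_expands alpha cv.
have hw := fracLap_expands (alpha / 2) dw.
rewrite (inner_expands (expands_bmeas hv) hw) (inner_expands (expands_bmeas fv) dw).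
congr (_ * _); apply: eq_bigr => k _.
rewrite (fourier_expands _ hv) (fourier_expands _ fv); case: ifP => _; last by rewrite !mul0r.
have -> : normk k `^ alpha = (normk k `^ (alpha / 2)) ^+ 2 :> R.
  by rewrite -powR_mulrn ?powR_ge0// -powRrM divfK.
set m := normk k `^ _; apply: complex_eqP; case: (c k) => a b; case: (d k) => a' b' /=; ring.
Qed.

(** The orthogonal projection on X_N is the partial Fourier sum.  Taking it as the
    partial sum of the fractional Laplacian of order 0, whose multiplier |k|^0 is 1
    for k = 0 too, yields its real-valuedness from [fracLap_psum_real]. *)
Lemma proj_expands (N : nat) f : exists2 p, expands (fourier f) N p &
  forall d w, bmeas f -> expands d N w -> inner f w = inner p w.
Proof.
have E x : (complex.Re (fracLap_psum 0 f N x))%:C =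
    \sum_(k <- freqs N) fourier f k * expi (dotk k x).
  have := fracLap_psum_real 0 f N x; have -> : fracLap_psum 0 f N x =
    \sum_(k <- freqs N) fourier f k * expi (dotk k x).
    by apply: eq_bigr => k _; rewrite powRr0 mul1r.
  by case: (\sum_(k <- _) _) => a b /= ->.
exists (fun x => complex.Re (fracLap_psum 0 f N x)) => // d w bf dw.
apply: complexI; rewrite (inner_expands bf dw) (inner_expands (expands_bmeas E) dw).
congr (_ * _); rewrite big_seq [RHS]big_seq; apply: eq_bigr => k kN.
by rewrite (fourier_expands _ E) kN.
Qed.

Lemma expands_XN c (N : nat) v : expands c N v -> XN N v.
Proof. by exists c. Qed.

(** Integration by parts moves the derivative onto v^2, and (v^2)' = 2 v v': the
    integral I of v^2 v' satisfies I = - 2 I. *)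
Lemma inner_sq_pd1 c (N : nat) v : expands c N v ->
  inner (fun x => v x ^+ 2) (pd1 v) = 0.
Proof.
move=> cv; have [e] := expandsM cv cv.
have -> : (fun x => v x * v x) = (fun x => v x ^+ 2) by [].
move=> ev; have bv := expands_bmeas cv; have bdv := expands_bmeas (pd1_expands cv).
have := inner_pd1_skew ev cv.
have -> : inner (pd1 (fun x => v x ^+ 2)) v = 2 * inner (fun x => v x ^+ 2) (pd1 v).
  rewrite /inner -intOmegaZ; last by apply: bmeasM => //; apply: bmeasM.
  congr intOmega; apply/funext => x.
  have D := expands_is_derive x cv.
  have := @derive_val _ _ _ _ _ _ _ (is_deriveM D D).
  rewrite /pd1 -[X in derive X]/(fun x => v x ^+ 2) => ->.
  by rewrite derive_val /GRing.scale /=; ring.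
by lra.
Qed.

End multipliers.

(** * Differentiation of curves of functions *)

Section time_derivatives.
Context {R : realType} (J : set R) (t : R).
Hypothesis Jt : J t.
Implicit Types (F G : R -> R).

#[local] Instance within_dnbhs_filter : Filter (within J t^').
Proof. exact: within_filter. Qed.

Lemma deriv_within_ext F G l : (forall s, J s -> F s = G s) ->
  deriv_within J G t l -> deriv_within J F t l.
Proof.
move=> FG dG; apply: (cvg_trans _ dG); apply: (@near_eq_cvg _ _ (within J t^')).
by rewrite near_withinE; near=> s => Js; rewrite !FG.
Unshelve. all: by end_near. Qed.

Lemma deriv_within_eq F l m : deriv_within J F t l -> l = m -> deriv_within J F t m.
Proof. by move=> + <-. Qed.

Lemma deriv_within_cst (c : R) : deriv_within J (fun=> c) t 0.
Proof.
rewrite /deriv_within; under eq_fun do rewrite subrr mul0r; exact: cvg_cst.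
Qed.

Lemma deriv_withinD F G l m : deriv_within J F t l -> deriv_within J G t m ->
  deriv_within J (fun s => F s + G s) t (l + m).
Proof.
rewrite /deriv_within => dF dG; apply: (cvg_trans _ (cvgD dF dG)).
apply: (@near_eq_cvg _ _ (within J t^')).
by near=> s; rewrite -[LHS]/((F s - F t) / (s - t) + (G s - G t) / (s - t)); ring.
Unshelve. all: by end_near. Qed.

Lemma deriv_within_continuous F l : deriv_within J F t l ->
  F @ within J t^' --> F t.
Proof.
move=> dF.
have h0 : (fun s => s - t) @ within J t^' --> (0 : R).
  rewrite -[X in _ --> X](subrr t); apply: cvgB; last exact: cvg_cst.
  by apply: cvg_within_filter; apply: cvg_within_filter.
have dFh : (fun s => (F s - F t) / (s - t) * (s - t) + F t) @ within J t^' --> F t.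
  rewrite -[X in _ --> X]add0r -[X in _ --> X + _](mulr0 l).
  by apply: cvgD; [exact: cvgM|exact: cvg_cst].
apply: (cvg_trans _ dFh); apply: (@near_eq_cvg _ _ (within J t^')).
rewrite near_withinE; near=> s => Js /=.
rewrite divfK ?subrK// subr_eq0; near: s.
exact: nbhs_dnbhs_neq.
Unshelve. all: by end_near. Qed.

Lemma deriv_withinM F G l m : deriv_within J F t l -> deriv_within J G t m ->
  deriv_within J (fun s => F s * G s) t (l * G t + F t * m).
Proof.
move=> dF dG; have cF := deriv_within_continuous dF.
move: dF dG; rewrite /deriv_within => dF dG.
apply: (cvg_trans _ (cvgD (cvgM dF (cvg_cst (G t))) (cvgM cF dG))).
apply: (@near_eq_cvg _ _ (within J t^')); near=> s.
rewrite -[LHS]/((F s - F t) / (s - t) * G t + F s * ((G s - G t) / (s - t))); ring.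
Unshelve. all: by end_near. Qed.

Lemma deriv_withinMr F (c l : R) : deriv_within J F t l ->
  deriv_within J (fun s => F s * c) t (l * c).
Proof.
move=> dF; have := deriv_withinM dF (deriv_within_cst c).
by rewrite mulr0 addr0.
Qed.

Lemma deriv_within_sum (I : Type) (r : seq I) (F : I -> R -> R) (l : I -> R) :
  (forall i, deriv_within J (F i) t (l i)) ->
  deriv_within J (fun s => \sum_(i <- r) F i s) t (\sum_(i <- r) l i).
Proof.
move=> dF; elim: r => [|i r IHr].
  by rewrite big_nil; under eq_fun do rewrite big_nil; exact: deriv_within_cst.
by rewrite big_cons; under eq_fun do rewrite big_cons; exact: deriv_withinD.
Qed.

(** Differentiability at t of a curve of finite rank.  With finitely many terms no
    topology on functions is needed: everything reduces to the scalar coefficients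
    a i. *)
Definition curve_diff (w : R -> R * R -> R) (w' : R * R -> R) :=
  exists (I : finType) (a : I -> R -> R) (a' : I -> R) (phi : I -> R * R -> R),
  [/\ forall i, bmeas (phi i), forall i, deriv_within J (a i) t (a' i),
      forall s, J s -> forall x, w s x = \sum_i a i s * phi i x &
      forall x, w' x = \sum_i a' i * phi i x].

Lemma curve_diffM v v' w w' : curve_diff v v' -> curve_diff w w' ->
  curve_diff (fun s x => v s x * w s x) (fun x => v' x * w t x + v t x * w' x).
Proof.
move=> [I [a [a' [phi [bphi da vE v'E]]]]] [K [b [b' [psi [bpsi db wE w'E]]]]].
exists (I * K)%type, (fun p s => a p.1 s * b p.2 s),
  (fun p => a' p.1 * b p.2 t + a p.1 t * b' p.2), (fun p x => phi p.1 x * psi p.2 x).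
split=> [p|p|s Js x|x].
- exact: bmeasM.
- exact: deriv_withinM.
- rewrite vE// wE// big_distrlr /= pair_bigA /=; apply: eq_bigr => p _; ring.
- rewrite v'E w'E vE// wE// !big_distrlr /= !pair_bigA /= -big_split /=.
  by apply: eq_bigr => p _; ring.
Qed.

Lemma curve_diff_intOmega w w' : curve_diff w w' ->
  deriv_within J (fun s => intOmega (w s)) t (intOmega w').
Proof.
move=> [I [a [a' [phi [bphi da wE w'E]]]]].
have b (c : I -> R) i : bmeas (fun x => c i * phi i x).
  by apply: bmeasM => //; exact: bmeas_cst.
have int_sum (c : I -> R) f : (forall x, f x = \sum_i c i * phi i x) ->
    intOmega f = \sum_i c i * intOmega (phi i).
  move=> fE; have -> : f = fun x => \sum_i c i * phi i x by apply/funext.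
  rewrite intOmega_sum; last exact: b.
  by apply: eq_bigr => i _; rewrite intOmegaZ.
rewrite (int_sum _ _ w'E).
apply: deriv_within_ext => [s Js|]; first exact: int_sum (wE _ Js).
by apply: deriv_within_sum => i; exact: deriv_withinMr.
Qed.

(** Real Fourier form of a curve in X_N: Re (c e^{i k.x}) splits into a cosine with
    coefficient Re c and a sine with coefficient - Im c, one of each for every
    frequency.  The real multiplier m covers both the curve itself (m = 1) and its
    fractional Laplacian. *)
Lemma curve_diff_expands (N : nat) (m : int * int -> R) (c : R -> int * int -> R[i]) c'
    (w : R -> R * R -> R) w' :
  (forall s, J s -> expands (fun k => (m k)%:C * c s k) N (w s)) ->
  expands (fun k => (m k)%:C * c' k) N w' ->
  (forall k, k \in freqs N ->
    deriv_within J (fun s => complex.Re (c s k)) t (complex.Re (c' k)) /\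
    deriv_within J (fun s => complex.Im (c s k)) t (complex.Im (c' k))) ->
  curve_diff w w'.
Proof.
move=> wE w'E dc.
pose kk (p : 'I_(size (freqs N)) * bool) := tnth (in_tuple (freqs N)) p.1.
pose coef (z : int * int -> R[i]) p :=
  if p.2 then complex.Re (z (kk p)) else complex.Im (z (kk p)).
pose phi p x := if p.2 then m (kk p) * cos (dotk (kk p) x)
  else - m (kk p) * sin (dotk (kk p) x).
have expandsE z f : expands (fun k => (m k)%:C * z k) N f ->
    forall x, f x = \sum_p coef z p * phi p x.
  move=> fE x; have -> : f x = complex.Re (f x)%:C by [].
  rewrite fE Re_sum big_tnth /= -(pair_bigA _ (fun i b => coef z (i, b) * phi (i, b) x)) /=.
  apply: eq_bigr => i _; rewrite big_bool /coef /phi /kk /=.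
  by case: (z _) => a b /=; ring.
exists ('I_(size (freqs N)) * bool)%type, (fun p s => coef (c s) p), (coef c'), phi.
split=> [p|p|s Js|].
- rewrite /phi; case: p.2; (apply: bmeasM; first exact: bmeas_cst); apply: bmeas_trig;
    (exact: continuous_cos || exact: cos_max || exact: continuous_sin || exact: sin_max).
- have [d1 d2] := dc (kk p) (mem_tnth _ _).
  by rewrite /coef; case: p.2.
- exact: expandsE (wE s Js).
- exact: expandsE.
Qed.

End time_derivatives.

(** * Fourier coefficients of a continuously differentiable curve *)

Section curve.
Context {R : realType} (N : nat) (J : set R) (u du : R -> R * R -> R) (t : R).
Hypothesis Jt : J t.
Hypothesis Cu : C1_curve N J u du.

Let coef_quotient s k : J s -> k \in freqs N -> s != t ->
  let r := (s - t)^-1 *: (u s - u t) - du t in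
  `|(complex.Re (fourier (u s) k) - complex.Re (fourier (u t) k)) / (s - t)
     - complex.Re (fourier (du t) k)| <= L2norm r /\
  `|(complex.Im (fourier (u s) k) - complex.Im (fourier (u t) k)) / (s - t)
     - complex.Im (fourier (du t) k)| <= L2norm r.
Proof.
move=> Js kN st r.
have [/XN_expands rs _ _ _] := Cu Js; have [/XN_expands rt /XN_expands rd _ _] := Cu Jt.
have rr : expands (fun k => ((s - t)^-1)%:C * (fourier (u s) k - fourier (u t) k)
     - fourier (du t) k) N r.
  move=> x; rewrite -[r x]/((s - t)^-1 * (u s x - u t x) - du t x).
  rewrite rmorphB rmorphM rmorphB /= rs rt rd -sumrB mulr_sumr -sumrB.
  by apply: eq_bigr => l _; ring.
have [] := coef_le_L2norm rr kN.
move: (fourier (u s) k) (fourier (u t) k) (fourier (du t) k) => [a b] [a' b'] [a'' b''] /=.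
by rewrite !mul0r subr0 addr0 !(mulrC (s - t)^-1).
Qed.

Lemma fourier_deriv k : k \in freqs N ->
  deriv_within J (fun s => complex.Re (fourier (u s) k)) t (complex.Re (fourier (du t) k)) /\
  deriv_within J (fun s => complex.Im (fourier (u s) k)) t (complex.Im (fourier (du t) k)).
Proof.
move=> kN; have [_ _ L0 _] := Cu Jt.
have sq F l : (forall s, J s -> s != t -> `|(F s - F t) / (s - t) - l| <=
    L2norm ((s - t)^-1 *: (u s - u t) - du t)) -> deriv_within J F t l.
  move=> H; apply/subr_cvg0/norm_cvg0P.
  apply: (@squeeze_cvgr _ _ _ _ (fun=> 0) _ _ _ _ _ L0); last exact: cvg_cst.
  rewrite near_withinE; near=> s => Js; rewrite normr_ge0 /=; apply: H => //.
  near: s; exact: nbhs_dnbhs_neq.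
split; apply: sq => s Js st; by have [] := coef_quotient Js kN st.
Unshelve. all: by end_near. Qed.

Lemma curve_diff_u : curve_diff J t u (du t).
Proof.
have [_ /XN_expands rd _ _] := Cu Jt.
apply: (curve_diff_expands (N := N) (m := fun=> 1)
  (c := fun s => fourier (u s)) (c' := fourier (du t))).
- by move=> s /Cu[/XN_expands rs _ _ _] x; rewrite rs; apply: eq_bigr => k _; rewrite mul1r.
- by move=> x; rewrite rd; apply: eq_bigr => k _; rewrite mul1r.
- exact: fourier_deriv.
Qed.

Lemma curve_diff_fracLap (beta : R) :
  curve_diff J t (fun s => fracLap beta (u s)) (fracLap beta (du t)).
Proof.
have [_ /XN_expands rd _ _] := Cu Jt.
apply: (curve_diff_expands (N := N) (m := fun k => normk k `^ beta)
  (c := fun s => fourier (u s)) (c' := fourier (du t))).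
- by move=> s /Cu[/XN_expands rs _ _ _]; exact: fracLap_expands.
- exact: fracLap_expands.
- exact: fourier_deriv.
Qed.

End curve.

(** * Orthogonality relations of the scheme at a fixed time *)

Section conservation.
Context {R : realType} (alpha : R) (N : nat) (v dv : R * R -> R).
Hypothesis Xv : XN N v.
Hypothesis Xdv : XN N dv.
Hypothesis scheme : forall w, XN N w ->
  inner dv w + inner (fracLap alpha v) (pd1 w)
  - 2^-1 * inner (fun x => v x ^+ 2) (pd1 w) = 0.

Let rv := XN_expands Xv.
Let rdv := XN_expands Xdv.
Let bv := expands_bmeas rv.
Let bdv := expands_bmeas rdv.
Let bfv := expands_bmeas (fracLap_expands alpha rv).
Let bv2 : bmeas (fun x => v x ^+ 2).
Proof. exact: bmeasM. Qed.

Lemma scheme_mass : intOmega dv = 0.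
Proof.
have r1 : expands (fun k => (k == 0)%:R) N (fun=> 1 : R).
  move=> x; rewrite (bigD1_seq 0) ?freqs_uniq ?mem_freqs//= big1 => [|k /negbTE ->].
    by rewrite addr0 mul1r /dotk /= !mul0r addr0 /expi cos0 sin0.
  by rewrite mul0r.
have d1 : pd1 (fun=> 1 : R) = fun=> 0.
  by apply/funext => x; exact: derive_cst.
have := scheme (expands_XN r1); rewrite d1.
have z (f : R * R -> R) : inner f (fun=> 0) = 0.
  rewrite -[RHS](mul0r (intOmega (fun=> 0))) -intOmegaZ; last exact: bmeas_cst.
  by congr intOmega; apply/funext => x; rewrite mulr0 mul0r.
rewrite !z mulr0 subr0 addr0 => <-.
by congr intOmega; apply/funext => x; rewrite mulr1.
Qed.

Lemma scheme_momentum : inner dv v = 0.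
Proof.
have := scheme Xv.
by rewrite (inner_fracLap_pd1 alpha rv) (inner_sq_pd1 rv) mulr0 subr0 addr0.
Qed.

(** The left-hand side is (w, dv) for the gradient w of the energy at v; the test
    function is the projection of w on X_N. *)
Lemma scheme_energy :
  inner (fracLap alpha v) dv - 2^-1 * inner (fun x => v x ^+ 2) dv = 0.
Proof.
pose w x := fracLap alpha v x + (- 2^-1) * v x ^+ 2.
have bw2 : bmeas (fun x => (- 2^-1) * v x ^+ 2) by apply: bmeasM => //; exact: bmeas_cst.
have bw : bmeas w by exact: bmeasD.
have wE g : bmeas g -> inner w g =
    inner (fracLap alpha v) g - 2^-1 * inner (fun x => v x ^+ 2) g.
  by move=> bg; rewrite innerDl// innerZl// mulNr.
have [p rp pE] := proj_expands N w.
have rdp := pd1_expands rp.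
rewrite -wE// (pE _ _ bw rdv) innerC.
have := scheme (expands_XN rp); rewrite -addrA -wE; last exact: expands_bmeas rdp.
rewrite (pE _ _ bw rdp) (_ : inner p (pd1 p) = 0) ?addr0//.
have := inner_pd1_skew rp rp; rewrite (innerC (pd1 p)); lra.
Qed.

End conservation.

(** * Conservation of mass, momentum and energy *)

Unset Implicit Arguments.

Theorem theorem3p1 (R : realType) (alpha : R) (N : nat) (u0 : R * R -> R)
    (J : interval R) (u : R -> R * R -> R) :
  0 < alpha -> alpha <= 2 ->
  L2per u0 ->
  0 \in J ->
  galerkin_solution alpha N u0 [set` J] u ->
  forall t : R, t \in J ->
    [/\ deriv_within [set` J] (fun s => mass (u s)) t 0,
        deriv_within [set` J] (fun s => momentum (u s)) t 0 &
        deriv_within [set` J] (fun s => energy alpha (u s)) t 0].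
Proof.
move=> _ _ _ _ [du [Cu scheme _]] t Jt.
have Jt' : [set` J] t by [].
have [Xu Xdu _ _] := Cu t Jt'.
have ru := XN_expands Xu; have rdu := XN_expands Xdu.
have bu := expands_bmeas ru; have bdu := expands_bmeas rdu.
have Du := curve_diff_u Jt' Cu.
have Du2 := curve_diffM Jt' Du Du.
split.
- by rewrite -(scheme_mass (scheme t Jt')); exact: curve_diff_intOmega.
- apply: deriv_within_eq (curve_diff_intOmega Jt' Du2) _.
  transitivity (2 * inner (du t) (u t)); last first.
    by rewrite (scheme_momentum Xu (scheme t Jt')) mulr0.
  rewrite -intOmegaZ; last exact: bmeasM.
  by congr intOmega; apply/funext => x; ring.
have rh := fracLap_expands (alpha / 2) ru; have rdh := fracLap_expands (alpha / 2) rdu.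
have bh := expands_bmeas rh; have bdh := expands_bmeas rdh.
have Dh := curve_diff_fracLap Jt' Cu (alpha / 2).
have dK := curve_diff_intOmega Jt' (curve_diffM Jt' Dh Dh).
have dC := curve_diff_intOmega Jt' (curve_diffM Jt' Du Du2).
have D := deriv_withinD (deriv_withinMr (c := 2^-1) dK) (deriv_withinMr (c := - 6^-1) dC).
apply: (deriv_within_eq (deriv_within_ext Jt' _ D)).
  move=> s _; rewrite /energy mulrC mulrN (mulrC 6^-1); congr (_ * _ - _ * _).
    by congr intOmega; apply/funext => x; rewrite real_normK ?num_real.
have -> : intOmega (fun x => fracLap (alpha / 2) (du t) x * fracLap (alpha / 2) (u t) x
     + fracLap (alpha / 2) (u t) x * fracLap (alpha / 2) (du t) x) =
   2 * inner (fracLap alpha (u t)) (du t).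
  rewrite -(inner_fracLap_half alpha ru rdu) -intOmegaZ; last exact: bmeasM.
  by congr intOmega; apply/funext => x; ring.
have -> : intOmega (fun x => du t x * (u t x * u t x)
     + u t x * (du t x * u t x + u t x * du t x)) =
   3 * inner (fun x => u t x ^+ 2) (du t).
  rewrite -intOmegaZ; last by apply: bmeasM => //; exact: bmeasM.
  by congr intOmega; apply/funext => x; ring.
have := scheme_energy Xu Xdu (scheme t Jt'); lra.
Qed.
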